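(* Let $\ell\ge5$ and $p=3$ with $9\mid N$ (with $f$, $N$, $\bar\rho$ as in the context). Suppose the inertial type at $3$ is non-exceptional supercuspidal with $K/\mathbb{Q}_3$ ramified. Then $\dim_\kappa H^0(G_3,\bar\varepsilon_\ell\otimes\mathrm{ad}^0\bar\rho)=0$, in each of the cases $3\not\equiv\pm1\pmod\ell$, $3\equiv-1\pmod\ell$ and $3\equiv1\pmod\ell$.
   Context: $f$ is a normalized weight $2$ newform of level $N$ corresponding to an elliptic curve $E_f/\mathbb{Q}$ of conductor $N$, $\kappa$ is a finite field of characteristic $\ell$ with $\ell\nmid N$, $S$ is a finite set of places of $\mathbb{Q}$ containing $\infty$ and the primes dividing $N\ell$, and $\bar\rho:G_{\mathbb{Q},S}\to\mathrm{GL}_2(\kappa)$ is the residual representation attached to $f$. Throughout: $\bar\rho$ is odd, continuous and absolutely irreducible, $f$ is ordinary at $\ell$ ($a_\ell(f)\not\equiv0\bmod\ell$), and the deformation problem for $\bar\rho$ is minimally ramified at all primes dividing $N$; at a prime $p$ of supercuspidal type this means that deformations restricted to $G_p$ are of the form $\mathrm{Ind}_{G_K}^{G_p}\chi$ with $\chi$ a lift of $\bar\chi$ (below) of the same conductor exponent. $G_3$ is a decomposition group at $3$; $\bar\varepsilon_\ell$ is the mod $\ell$ cyclotomic character; $\mathrm{ad}^0\bar\rho$ is the space of trace-zero $2\times2$ matrices over $\kappa$ with conjugation action via $\bar\rho$. $E_f$ has additive, potentially good reduction at $3$. $\tau_{\mathrm{sc},3}(d,c,r)$ denotes the inertial type of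 $\mathrm{Ind}_{G_K}^{G_3}\chi$ with $K=\mathbb{Q}_3(\sqrt d)$, $\chi$ of conductor exponent $c$ and order $r$ on $I_K$. The types with $K$ ramified are $\tau_{\mathrm{sc},3}(\pm3,2,6)$ with $K=\mathbb{Q}_3(\sqrt{\pm3})$, and $\tau_{\mathrm{sc},3}(-3,4,6)_j$, $j=0,1,2$, with $K=\mathbb{Q}_3(\sqrt{-3})$, where the inducing character $\chi_j$, viewed on $\mathcal{O}_K^\times$ by class field theory, satisfies $\chi_j(-\xi_6)=\zeta_3^{\,j}$ and $\chi_j(\xi_6-3)=-\zeta_3^{\,j-1}$, with $\xi_6\in K$ a primitive sixth root of unity and $\zeta_3$ a primitive cube root of unity. Residually $\bar\rho|_{G_3}\cong\mathrm{Ind}_{G_K}^{G_3}\bar\chi$, where $\bar\chi$ is the reduction of the inducing character, $\bar\chi\ne\bar\chi^s$ with $\bar\chi^s$ the conjugate of $\bar\chi$ under $\mathrm{Gal}(K/\mathbb{Q}_3)$. *)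

(* Defs.v *)
From HB Require Import structures.
From mathcomp Require Import all_boot all_order all_algebra all_field.
From mathcomp Require Import all_classical all_reals all_analysis.
From mathcomp Require Import complex.
Set Implicit Arguments.
Unset Strict Implicit.
Unset Printing Implicit Defensive.
Import Order.TTheory GRing.Theory Num.Theory numFieldNormedType.Exports.
Local Open Scope classical_set_scope.
Local Open Scope card_scope.
Local Open Scope ring_scope.

Section ComplexAnalysis.
Variable C : numFieldType.

Definition holomorphic_on (U : set C) (f : C -> C) : Prop :=
  forall z, U z -> derivable (f : C^o -> C^o) z 1.

Definition sums_to (u : nat -> C) (l : C) : Prop :=
  series (u : nat -> C^o) @ \oo --> (l : C^o).

End ComplexAnalysis.

Section ModularForms.
Variable R : realType.
Notation C := (complex R).
Implicit Types (f g h : C -> C) (z : C) (A : 'M[int]_2) (N M d p : nat).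

Definition upper_half : set C := [set z | 0 < complex.Im z].

Definition auto_factor A z : C := (A 1 0)%:~R * z + (A 1 1)%:~R.

Definition moebius A z : C :=
  ((A 0 0)%:~R * z + (A 0 1)%:~R) / auto_factor A z.

Definition slash2 A f : C -> C :=
  fun z => (auto_factor A z) ^- 2 * f (moebius A z).

Definition SL2Z : set 'M[int]_2 := [set A : 'M[int]_2 | \det A = 1].

Definition Gamma0 N : set 'M[int]_2 :=
  [set A : 'M[int]_2 | \det A = 1 /\ (N%:Z %| (A 1 0)%R)%Z].

Record cusp_form2 N f : Prop := CuspForm2 {
  cusp_holomorphic : holomorphic_on upper_half f;
  cusp_invariant : forall A, Gamma0 N A ->
    forall z, upper_half z -> slash2 A f z = f z;
  cusp_vanishing : forall A, SL2Z A -> forall e : R, 0 < e ->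
    exists Y : R, forall z, upper_half z -> Y < complex.Im z ->
      `|slash2 A f z| < (e%:C)%C }.

Definition qexp z : C :=
  Complex (expR (- (2 * pi * complex.Im z)) * cos (2 * pi * complex.Re z))
          (expR (- (2 * pi * complex.Im z)) * sin (2 * pi * complex.Re z)).

Definition q_expansion f (a : nat -> int) : Prop :=
  forall z, upper_half z -> sums_to (fun n => (a n)%:~R * qexp z ^+ n) (f z).

Definition hecke2 N p f : C -> C := fun z =>
  p%:R^-1 * (\sum_(j < p) f ((z + j%:R) / p%:R))
  + (if (p %| N)%N then 0 else p%:R * f (p%:R * z)).

(* The standard fundamental domain of SL_2(Z), as a subset of R^2. *)
Definition fund_domain : set (R * R) :=
  [set w | [/\ `|w.1| <= 2^-1, 1 <= w.1 ^+ 2 + w.2 ^+ 2 & 0 < w.2]].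

Definition integral_fd (h : C -> C) : C :=
  let mu := (lebesgue_measure \x lebesgue_measure)%E in
  Complex (Rintegral mu fund_domain (fun w => complex.Re (h (Complex w.1 w.2))))
          (Rintegral mu fund_domain (fun w => complex.Im (h (Complex w.1 w.2)))).

(* T lists representatives of Gamma_0(N)\SL_2(Z); on SL_2(Z), \adj is the
   inverse. *)
Definition coset_reps N (T : seq 'M[int]_2) : Prop :=
  {in T, forall t, SL2Z t} /\
  forall A, SL2Z A -> count (fun t => `[< Gamma0 N (A *m \adj t) >]) T = 1%N.

(* In weight 2 the integrand f g^* y^2 (dx dy)/y^2 is f g^* dx dy; the integral
   over Gamma_0(N)\H is unfolded along the cosets.  The usual normalising
   volume factor is irrelevant to orthogonality. *)
Definition petersson (T : seq 'M[int]_2) f g : C :=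
  \sum_(t <- T) integral_fd (fun z => slash2 t f z * conjc (slash2 t g z)).

Definition is_new N f : Prop :=
  forall T, coset_reps N T ->
  forall M d h, (0 < M)%N -> (M < N)%N -> (M * d %| N)%N -> cusp_form2 M h ->
  petersson T f (fun z => h (d%:R * z)) = 0.

Record normalized_newform2 N f (a : nat -> int) : Prop := Newform2 {
  newform_cusp : cusp_form2 N f;
  newform_qexp : q_expansion f a;
  newform_normalized : a 1%N = 1;
  newform_hecke : forall p, prime p ->
    exists c : C, forall z, upper_half z -> hecke2 N p f z = c * f z;
  newform_new : is_new N f }.

End ModularForms.

(* algC is an algebraic closure of Q; its ring endomorphisms are bijective
   (algC_invaut), so they are the elements of Gal(Qbar/Q). *)
Definition galQ : Type := {rmorphism algC -> algC}.

Definition galQ1 : galQ := idfun.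
Definition galQM (s t : galQ) : galQ := s \o t.
Definition galQV (s : galQ) : galQ := algC_invaut s.
Definition complex_conj : galQ := Num.conj.

Definition fixes (s : galQ) (xs : seq algC) : Prop := {in xs, forall x, s x = x}.

(* The place of Qbar above p given by a valuation with v(p) = 1; the value v 0
   is irrelevant. *)
Record place_over (p : nat) (v : algC -> rat) : Prop := PlaceOver {
  placeM : forall x y, x != 0 -> y != 0 -> v (x * y) = v x + v y;
  placeD : forall x y, x != 0 -> y != 0 -> x + y != 0 ->
    Num.min (v x) (v y) <= v (x + y);
  place_p : v p%:R = 1 }.

Definition val_ge (v : algC -> rat) (r : rat) (x : algC) : Prop :=
  x = 0 \/ r <= v x.
Definition val_gt (v : algC -> rat) (r : rat) (x : algC) : Prop :=
  x = 0 \/ r < v x.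

(* The stabiliser of a place over p is canonically Gal(Qbar_p/Q_p), and the
   subfield of Qbar fixed by a closed subgroup of it is dense in the
   corresponding (completed) extension of Q_p. *)
Definition decomposition (v : algC -> rat) : set galQ :=
  [set s | forall x, v (s x) = v x].

Definition inertia (v : algC -> rat) : set galQ :=
  [set s | decomposition v s /\
           forall x, val_ge v 0 x -> val_gt v 0 (s x - x)].

(* s acts as the q-th power map on the residue field of v *)
Definition frobenius (v : algC -> rat) (q : nat) (s : galQ) : Prop :=
  decomposition v s /\ forall x, val_ge v 0 x -> val_gt v 0 (s x - x ^+ q).

Definition fixed_field (H : set galQ) : set algC :=
  [set x | forall s, H s -> s x = x].

Record weierstrass (A : Type) : Type :=
  Weierstrass { wa1 : A; wa2 : A; wa3 : A; wa4 : A; wa6 : A }.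

Definition wmap (A B : Type) (h : A -> B) (W : weierstrass A) : weierstrass B :=
  Weierstrass (h (wa1 W)) (h (wa2 W)) (h (wa3 W)) (h (wa4 W)) (h (wa6 W)).

Section WeierstrassInvariants.
Variables (A : comNzRingType) (W : weierstrass A).
Let a1 := wa1 W. Let a2 := wa2 W. Let a3 := wa3 W.
Let a4 := wa4 W. Let a6 := wa6 W.

Definition wb2 := a1 ^+ 2 + 4 * a2.
Definition wb4 := 2 * a4 + a1 * a3.
Definition wb6 := a3 ^+ 2 + 4 * a6.
Definition wb8 :=
  a1 ^+ 2 * a6 + 4 * a2 * a6 - a1 * a3 * a4 + a2 * a3 ^+ 2 - a4 ^+ 2.
Definition wc4 := wb2 ^+ 2 - 24 * wb4.
Definition wdisc :=
  - wb2 ^+ 2 * wb8 - 8 * wb4 ^+ 3 - 27 * wb6 ^+ 2 + 9 * wb2 * wb4 * wb6.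

Definition on_curve (P : A * A) : bool :=
  P.2 ^+ 2 + a1 * P.1 * P.2 + a3 * P.2
    == P.1 ^+ 3 + a2 * P.1 ^+ 2 + a4 * P.1 + a6.

(* The division polynomials cutting out the nonzero 2- and 3-torsion *)
Definition wpsi2 (P : A * A) : A := 2 * P.2 + a1 * P.1 + a3.
Definition wpsi3 (P : A * A) : A :=
  3 * P.1 ^+ 4 + wb2 * P.1 ^+ 3 + 3 * wb4 * P.1 ^+ 2 + 3 * wb6 * P.1 + wb8.

End WeierstrassInvariants.

(* W' is obtained from W by x = u^2 x' + r, y = u^3 y' + s u^2 x' + t *)
Definition wchange (F : fieldType) (u r s t : F) (W W' : weierstrass F) : Prop :=
  [/\ u * wa1 W' = wa1 W + 2 * s,
      u ^+ 2 * wa2 W' = wa2 W - s * wa1 W + 3 * r - s ^+ 2,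
      u ^+ 3 * wa3 W' = wa3 W + r * wa1 W + 2 * t,
      u ^+ 4 * wa4 W' = wa4 W - s * wa3 W + 2 * r * wa2 W
                        - (t + r * s) * wa1 W + 3 * r ^+ 2 - 2 * s * t
    & u ^+ 6 * wa6 W' = wa6 W + r * wa4 W + r ^+ 2 * wa2 W + r ^+ 3
                        - t * wa3 W - t ^+ 2 - r * t * wa1 W].

Definition wisom (F : fieldType) (W W' : weierstrass F) : Prop :=
  exists u r s t : F, u != 0 /\ wchange u r s t W W'.

(* A global minimal Weierstrass model of an elliptic curve over Q; every
   elliptic curve over Q has one. *)
Definition minimal_model (W : weierstrass int) : Prop :=
  wdisc W != 0 /\
  forall W' : weierstrass int,
    wisom (wmap (intr : int -> rat) W) (wmap (intr : int -> rat) W') ->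
    `|wdisc W| <= `|wdisc W'|.

Definition good_reduction (p : nat) (W : weierstrass int) : Prop :=
  ~~ (p%:Z %| wdisc W)%Z.
Definition multiplicative_reduction (p : nat) (W : weierstrass int) : Prop :=
  (p%:Z %| wdisc W)%Z /\ ~~ (p%:Z %| wc4 W)%Z.
Definition additive_reduction (p : nat) (W : weierstrass int) : Prop :=
  (p%:Z %| wdisc W)%Z /\ (p%:Z %| wc4 W)%Z.

Definition curve_over_Qbar (W : weierstrass int) : weierstrass algC :=
  wmap (intr : int -> algC) W.

(* Good reduction, at the place v, over some finite extension *)
Definition potentially_good (v : algC -> rat) (W : weierstrass int) : Prop :=
  exists W' : weierstrass algC,
    [/\ wisom (curve_over_Qbar W) W',
        [/\ val_ge v 0 (wa1 W'), val_ge v 0 (wa2 W'), val_ge v 0 (wa3 W'),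
            val_ge v 0 (wa4 W') & val_ge v 0 (wa6 W')]
      & v (wdisc W') = 0].

(* The number of points of the reduction mod p, including the point at
   infinity *)
Definition card_mod (p : nat) (W : weierstrass int) : nat :=
  #|[set P : 'F_p * 'F_p | on_curve (wmap (intr : int -> 'F_p) W) P]%SET|.+1.

Definition corresponds (a : nat -> int) (W : weierstrass int) : Prop :=
  forall p : nat, prime p -> a p = p%:Z + 1 - (card_mod p W)%:Z.

(* The wild part of the conductor exponent at p is
     sum_(i >= 1) #G_i / #G_0 * dim E[q] / E[q]^(G_i),
   where the G_i are the lower ramification groups of Q_p(E[q])/Q_p and q is
   any prime other than p. *)
Definition aux_prime (p : nat) : nat := if p == 2%N then 3%N else 2%N.

Definition aux_torsion (p : nat) (W : weierstrass int) : pred (algC * algC) :=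
  fun P => let WC := curve_over_Qbar W in
    on_curve WC P && ((if p == 2%N then wpsi3 WC P else wpsi2 WC P) == 0).

Definition gal_point (s : galQ) (P : algC * algC) : algC * algC := (s P.1, s P.2).

Section Swan.
Variables (p : nat) (v : algC -> rat) (W : weierstrass int).

Definition torsion_field : set algC :=
  fixed_field [set s | decomposition v s /\
                       forall P, aux_torsion p W P -> gal_point s P = P].

Definition torsion_uniformizer (w : algC) : Prop :=
  [/\ torsion_field w, w != 0, 0 < v w
    & forall x, torsion_field x -> x != 0 -> 0 < v x -> v w <= v x].

(* The preimage of G_i in the decomposition group *)
Definition ramification (w : algC) (i : nat) : set galQ :=
  [set s | decomposition v s /\
     forall x, torsion_field x -> val_ge v 0 x ->
       val_ge v (i.+1%:R * v w) (s x - x)].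

Definition swan_exponent (delta : nat) : Prop :=
  exists (Ps : seq (algC * algC)) (w : algC) (m : nat) (g d : nat -> nat),
  [/\ uniq Ps /\ Ps =i aux_torsion p W,
      torsion_uniformizer w,
      forall i, [set map (gal_point s) Ps | s in ramification w i]
                  #= `I_(g i),
      forall i, [set P | P \in Ps /\
                         forall s, ramification w i s -> gal_point s P = P]
                  #= `I_((aux_prime p ^ d i).-1)
    & (forall i, (m < i)%N -> d i = 2%N) /\
      (delta * g 0 = \sum_(1 <= i < m.+1) g i * (2 - d i))%N].

End Swan.

Definition conductor_exponent_at (p : nat) (W : weierstrass int) (e : nat) : Prop :=
  [/\ good_reduction p W -> e = 0%N,
      multiplicative_reduction p W -> e = 1%N
    & additive_reduction p W -> forall v, place_over p v ->
        exists2 delta, swan_exponent p v W delta & e = (2 + delta)%N].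

Definition conductor (W : weierstrass int) (N : nat) : Prop :=
  (0 < N)%N /\ forall p, prime p -> conductor_exponent_at p W (logn p N).

(* Ol is the ring of integers of a finite extension of Q_l, with residue field k:
   a complete discrete valuation ring of characteristic 0 with finite residue
   field. *)
Definition coefficient_ring (Ol : idomainType) (k : finFieldType)
    (res : {rmorphism Ol -> k}) : Prop :=
  exists w : Ol,
  [/\ w != 0 /\ (forall n : nat, (0 < n)%N -> n%:R != 0 :> Ol),
      (forall y : k, exists x : Ol, res x = y),
      (forall x : Ol, res x = 0 <-> exists y, x = w * y),
      (forall x : Ol, (forall n, exists y, x = w ^+ n * y) -> x = 0)
    & (forall u : nat -> Ol, (forall n, exists y, u n.+1 - u n = w ^+ n * y) ->
         exists x, forall n, exists y, x - u n = w ^+ n * y)].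

Section Representations.
Variables (A : comNzRingType) (rho : galQ -> 'M[A]_2).

Definition representation : Prop :=
  rho galQ1 = 1%:M /\ forall s t, rho (galQM s t) = rho s *m rho t.

(* Places of Q: None is the infinite place, Some p the prime p.  A
   representation of G_(Q,S) is one of Gal(Qbar/Q) unramified outside S. *)
Definition unramified_outside (S : seq (option nat)) : Prop :=
  (None \notin S -> rho complex_conj = 1%:M) /\
  forall p v, prime p -> Some p \notin S -> place_over p v ->
    forall s, inertia v s -> rho s = 1%:M.

End Representations.

Definition continuous_residual (k : finFieldType) (rho : galQ -> 'M[k]_2) : Prop :=
  exists xs : seq algC, forall s, fixes s xs -> rho s = 1%:M.

(* Continuity for the l-adic topology, which is the topology of a
   coefficient ring of residue characteristic l *)
Definition continuous_adic (l : nat) (Ol : comNzRingType) (rho : galQ -> 'M[Ol]_2) :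
    Prop :=
  forall n, exists xs : seq algC, forall s, fixes s xs ->
    forall i j, exists y, rho s i j = (1%:M : 'M[Ol]_2) i j + (l ^ n)%:R * y.

Definition odd_rep (k : fieldType) (rho : galQ -> 'M[k]_2) : Prop :=
  \det (rho complex_conj) = -1.

Definition irreducible_rep (F : fieldType) (rho : galQ -> 'M[F]_2) : Prop :=
  forall U : {vspace 'cV[F]_2},
    (forall s u, u \in U -> rho s *m u \in U) -> U = 0%VS \/ U = fullv.

Definition absolutely_irreducible_rep (k : fieldType) (rho : galQ -> 'M[k]_2) :
    Prop :=
  forall (F : fieldType) (h : {rmorphism k -> F}),
    irreducible_rep (fun s => map_mx h (rho s)).

Definition equiv_on (F : fieldType) (H : set galQ) (rho rho' : galQ -> 'M[F]_2) :
    Prop :=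
  exists2 P : 'M[F]_2, P \in unitmx &
    forall s, H s -> rho s *m P = P *m rho' s.

(* det rho is the l-adic cyclotomic character *)
Definition cyclotomic_det (l : nat) (Ol : comNzRingType) (rho : galQ -> 'M[Ol]_2) :
    Prop :=
  forall (n j : nat) (s : galQ) (z : algC),
    (l ^ n)%N.-primitive_root z -> s z = z ^+ j ->
    exists y, \det (rho s) = j%:R + (l ^ n)%:R * y.

(* rho is an integral form over Ol of the l-adic representation attached to the
   weight 2 newform of level N with coefficients a (arithmetic Frobenius).
   The determinant at Frobenius elements is p because the weight is 2 and the
   nebentypus is trivial, i.e. det rho is cyclotomic. *)
Record attached_rep (N l : nat) (a : nat -> int) (Ol : comNzRingType)
    (rho : galQ -> 'M[Ol]_2) : Prop := AttachedRep {
  attached_hom : representation rho;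
  attached_cont : continuous_adic l rho;
  attached_unram : forall p v, prime p -> ~~ (p %| N * l)%N -> place_over p v ->
    forall s, inertia v s -> rho s = 1%:M;
  attached_trace : forall p v, prime p -> ~~ (p %| N * l)%N -> place_over p v ->
    forall s, frobenius v p s -> \tr (rho s) = (a p)%:~R;
  attached_det : cyclotomic_det l rho }.

(* The residue field k' of Ol may be larger than the field of definition k of
   rhobar. *)
Definition residual_of (k k' : finFieldType) (h : {rmorphism k -> k'})
    (Ol : idomainType) (res : {rmorphism Ol -> k'})
    (rhobar : galQ -> 'M[k]_2) (rho : galQ -> 'M[Ol]_2) : Prop :=
  equiv_on setT (fun s => map_mx h (rhobar s)) (fun s => map_mx res (rho s)).

(* The subgroup G_K of the decomposition group, for K = Q_p(rd) *)
Definition decompositionK (v : algC -> rat) (rd : algC) : set galQ :=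
  [set s | decomposition v s /\ s rd = rd].

Definition inertiaK (v : algC -> rat) (rd : algC) : set galQ :=
  [set s | inertia v s /\ s rd = rd].

Section Reciprocity.
Variables (v : algC -> rat) (G : set galQ).
Let K := fixed_field G.

(* The extension K(xs)/K is (Galois and) abelian. *)
Definition abelian_ext (xs : seq algC) : Prop :=
  forall s t, G s -> G t -> {in xs, forall x, s (t x) = t (s x)}.

(* x is the norm of an element y of K(xs)^*; the t i represent Gal(K(xs)/K). *)
Definition is_norm (xs : seq algC) (x : algC) : Prop :=
  exists (y : algC) (n : nat) (t : 'I_n -> galQ),
  [/\ y != 0 /\ (forall s, G s -> fixes s xs -> s y = y),
      forall i, G (t i),
      forall s, G s -> exists! i, {in xs, t i =1 s}
    & x = \prod_(i < n) t i y].

(* rec x is a lift to G of the image of x in K^* under the Artin map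
   K^* -> G^ab of a local field with residue field of order q and
   v(uniformizer) = e.  The Artin map is characterised as the homomorphism
   sending uniformizers to (arithmetic) Frobenius elements and norms from L^* to
   elements acting trivially on L, for every finite abelian L/K. *)
Definition local_reciprocity (q : nat) (e : rat) (rec : algC -> galQ) : Prop :=
  [/\ forall x, K x -> x != 0 -> G (rec x),
      forall x y, K x -> x != 0 -> K y -> y != 0 ->
        forall xs, abelian_ext xs ->
        {in xs, forall z, rec (x * y) z = rec x (rec y z)},
      forall x, K x -> x != 0 -> v x = e -> frobenius v q (rec x)
    & forall xs, abelian_ext xs -> forall x, is_norm xs x -> fixes (rec x) xs].

(* The unit filtration U^0 = O_K^*, U^c = 1 + m_K^c *)
Definition unit_filtration (e : rat) (c : nat) : set algC :=
  [set x | [/\ K x, x != 0, v x = 0 & val_ge v (c%:R * e) (x - 1)]].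

Definition char_conductor (e : rat) (rec : algC -> galQ) (A : comNzRingType)
    (chi : galQ -> A) (c : nat) : Prop :=
  (forall x, unit_filtration e c x -> chi (rec x) = 1) /\
  forall c', (c' < c)%N ->
    exists2 x, unit_filtration e c' x & chi (rec x) != 1.

End Reciprocity.

Definition adic_character (l : nat) (Ol : comNzRingType) (G : set galQ)
    (chi : galQ -> Ol) : Prop :=
  [/\ chi galQ1 = 1,
      forall s t, G s -> G t -> chi (galQM s t) = chi s * chi t
    & forall n, exists xs : seq algC, forall s, G s -> fixes s xs ->
        exists y, chi s = 1 + (l ^ n)%:R * y].

Definition order_on (A : comNzRingType) (I : set galQ) (chi : galQ -> A)
    (r : nat) : Prop :=
  [/\ (0 < r)%N, forall s, I s -> chi s ^+ r = 1
    & forall m, (0 < m)%N -> (m < r)%N -> exists2 s, I s & chi s ^+ m != 1].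

(* Ind_{G_K}^{G_p} chi on the coset representatives 1, c, with c rd = - rd:
   the (i, j) entry at s is chi(t_i^-1 s t_j), chi being extended by 0 outside
   G_K.  Meaningful for s in the decomposition group. *)
Definition ind_rep (rd : algC) (c : galQ) (A : comNzRingType) (chi : galQ -> A) :
    galQ -> 'M[A]_2 :=
  fun s => \matrix_(i < 2, j < 2)
    let t (i : 'I_2) := if i == 0 then galQ1 else c in
    let g := galQM (galQM (galQV (t i)) s) (t j) in
    if g rd == rd then chi g else 0.

Definition conj_char (c : galQ) (A : Type) (chi : galQ -> A) : galQ -> A :=
  fun s => chi (galQM (galQM (galQV c) s) c).

(* The inertial types tau_(sc,3)(3,2,6), tau_(sc,3)(-3,2,6) and
   tau_(sc,3)(-3,4,6)_j of Ind chi, for K = Q_3(rd), rd^2 = d; here K is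
   ramified, so its residue field is F_3 and its uniformizers have valuation
   1/2. *)
Definition ramified_sc_type3 (v : algC -> rat) (d : int) (rd : algC)
    (rec : algC -> galQ) (Ol : idomainType) (chi : galQ -> Ol) : Prop :=
  let cond := char_conductor v (decompositionK v rd) 2^-1 rec chi in
  let ord := order_on (inertiaK v rd) chi in
  [\/ [/\ d = 3, cond 2%N & ord 6%N],
      [/\ d = -3, cond 2%N & ord 6%N]
    | [/\ d = -3, cond 4%N & ord 6%N] /\
      exists (j : 'I_3) (xi6 : algC) (zeta3 : Ol),
      [/\ 6.-primitive_root xi6, 3.-primitive_root zeta3,
          chi (rec (- xi6)) = zeta3 ^+ j
        & chi (rec (xi6 - 3)) = - (zeta3 ^ (j%:Z - 1))]].

(* chi is a minimally ramified lift of its reduction res \o chi: the two have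
   the same conductor exponent. *)
Definition minimally_ramified_char (v : algC -> rat) (rd : algC)
    (rec : algC -> galQ) (Ol : idomainType) (k : fieldType)
    (res : {rmorphism Ol -> k}) (chi : galQ -> Ol) : Prop :=
  forall m, char_conductor v (decompositionK v rd) 2^-1 rec chi m <->
            char_conductor v (decompositionK v rd) 2^-1 rec (res \o chi) m.

(* For l prime, the unique j < l with s zeta = zeta^j, zeta a primitive l-th
   root of unity, viewed in k. *)
Definition mod_cyclotomic (l : nat) (k : fieldType) (s : galQ) : k :=
  let zeta := sval (C_prim_root_exists (ltn0Sn l.-1)) in
  \sum_(j < l | s zeta == zeta ^+ j) j%:R.

(* H^0(G, eps (x) ad^0 rho): the trace-zero matrices invariant under the
   eps-twisted conjugation action.  They form a subspace (mem_H0_ad0). *)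
Definition H0_ad0_set (k : fieldType) (G : set galQ) (eps : galQ -> k)
    (rho : galQ -> 'M[k]_2) : set 'M[k]_2 :=
  [set X | \tr X = 0 /\
           forall s, G s -> eps s *: (rho s *m X *m invmx (rho s)) = X].

Definition H0_ad0 (k : finFieldType) (G : set galQ) (eps : galQ -> k)
    (rho : galQ -> 'M[k]_2) : {vspace 'M[k]_2} :=
  span [seq X <- enum {: 'M[k]_2} | `[< H0_ad0_set G eps rho X >]].

Lemma mem_H0_ad0 (k : finFieldType) (G : set galQ) (eps : galQ -> k)
    (rho : galQ -> 'M[k]_2) (X : 'M[k]_2) :
  X \in H0_ad0 G eps rho <-> H0_ad0_set G eps rho X.
Proof.
split=> [|HX]; last first.
  by apply: memv_span; rewrite mem_filter mem_enum inE andbT; apply/asboolP.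
pose s := [seq X <- enum {: 'M[k]_2} | `[< H0_ad0_set G eps rho X >]].
have Hs (i : 'I_(size s)) : H0_ad0_set G eps rho s`_i.
  have := mem_nth 0 (ltn_ord i).
  by rewrite mem_filter => /andP[/asboolP].
move/(coord_span (X := in_tuple s))=> ->; split=> [|t Gt].
  by rewrite raddf_sum big1 //= => i _; rewrite linearZ /= (Hs i).1 mulr0.
rewrite mulmx_sumr mulmx_suml scaler_sumr; apply: eq_bigr => i _.
rewrite -[in RHS]((Hs i).2 t Gt) -scalemxAr -scalemxAl !scalerA mulrC //.
Qed.

(* Main.v *)
(* The determinant of rhobar on G_3 is the mod l cyclotomic character eps, and on
   G_K the induced representation is diag(chibar, chibar^c).  If E = (e_ij) is
   an invariant of eps (x) ad rhobar, written in the induced basis, then: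
   - a Frobenius element of G_K (the image of the uniformizer rd under the
     reciprocity map) multiplies e_00 and e_11 by eps = 3 <> 1, so both vanish;
   - on I_K the product chibar chibar^c = eps is trivial, so chibar = chibar^c
     there would give chibar^2 = 1 on I_K.  As chi has order 6 on I_K and
     reduction mod l >= 5 is injective on sixth roots of unity, some element of
     I_K separates chibar from chibar^c, which forces e_01 = e_10 = 0.
   The three congruence cases thus need no separate treatment. *)
Require Import Defs.
From HB Require Import structures.
From mathcomp Require Import all_boot all_order all_algebra all_field.
From mathcomp Require Import all_classical all_reals all_analysis.
From mathcomp Require Import complex.
Set Implicit Arguments.
Unset Strict Implicit.
Unset Printing Implicit Defensive.
Import Order.TTheory GRing.Theory Num.Theory.
Local Open Scope classical_set_scope.
Local Open Scope ring_scope.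

(** * Valuations, and reduction of roots of unity of order prime to [p] *)

Section Place.
Variables (p : nat) (v : algC -> rat).
Hypothesis hv : place_over p v.

Lemma place1 : v 1 = 0.
Proof.
have /eqP := placeM hv (oner_neq0 _) (oner_neq0 _).
by rewrite mulr1 -subr_eq0 opprD addrA subrr sub0r oppr_eq0 => /eqP.
Qed.

Lemma placeX x n : x != 0 -> v (x ^+ n) = n%:R * v x.
Proof.
move=> x0; elim: n => [|n IHn]; first by rewrite expr0 place1 mul0r.
by rewrite exprS (placeM hv) ?expf_neq0 // IHn mulrSr mulrDl mul1r addrC.
Qed.

Lemma placeN x : v (- x) = v x.
Proof.
have [->|x0] := eqVneq x 0; first by rewrite oppr0.
have N1 : v (-1) = 0.
  have := @placeX (-1) 2; rewrite oppr_eq0 oner_eq0 sqrrN expr1n place1.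
  by move=> /(_ isT) /esym/eqP; rewrite mulf_eq0 pnatr_eq0 /= => /eqP.
by rewrite -mulN1r (placeM hv) ?oppr_eq0 ?oner_eq0 // N1 add0r.
Qed.

Lemma val_gt1 : ~ val_gt v 0 1.
Proof. by case=> [/eqP|]; rewrite ?oner_eq0 // place1 ltxx. Qed.

Lemma val_gtD x y : val_gt v 0 x -> val_gt v 0 y -> val_gt v 0 (x + y).
Proof.
have [->|x0] := eqVneq x 0; first by rewrite add0r.
have [->|y0] := eqVneq y 0; first by rewrite addr0.
have [->|xy0] := eqVneq (x + y) 0; first by left.
move=> [/eqP|vx]; first by rewrite (negPf x0).
move=> [/eqP|vy]; first by rewrite (negPf y0).
by right; apply: lt_le_trans (placeD hv x0 y0 xy0); rewrite lt_min vx.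
Qed.

Lemma val_geD x y : val_ge v 0 x -> val_ge v 0 y -> val_ge v 0 (x + y).
Proof.
have [->|x0] := eqVneq x 0; first by rewrite add0r.
have [->|y0] := eqVneq y 0; first by rewrite addr0.
have [->|xy0] := eqVneq (x + y) 0; first by left.
move=> [/eqP|vx]; first by rewrite (negPf x0).
move=> [/eqP|vy]; first by rewrite (negPf y0).
by right; apply: le_trans (placeD hv x0 y0 xy0); rewrite le_min vx.
Qed.

Lemma val_gtN x : val_gt v 0 x -> val_gt v 0 (- x).
Proof. by case=> [->|vx]; [left; rewrite oppr0|right; rewrite placeN]. Qed.

Lemma val_gtM x y : val_ge v 0 x -> val_gt v 0 y -> val_gt v 0 (x * y).
Proof.
have [->|x0] := eqVneq x 0; first by rewrite mul0r; left.
have [->|y0] := eqVneq y 0; first by rewrite mulr0; left.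
move=> [/eqP|vx]; first by rewrite (negPf x0).
move=> [/eqP|vy]; first by rewrite (negPf y0).
by right; rewrite (placeM hv) // ltr_wpDl.
Qed.

Lemma val_gt_nat n x : val_gt v 0 x -> val_gt v 0 (n%:R * x).
Proof.
move=> vx; elim: n => [|n IHn]; first by rewrite mul0r; left.
by rewrite mulrSr mulrDl mul1r; apply: val_gtD.
Qed.

(** A Bezout relation between [p] and [n] would otherwise put 1 in the maximal ideal. *)
Lemma val_gt_coprime n : (0 < p)%N -> coprime p n -> ~ val_gt v 0 n%:R.
Proof.
move=> p0 /eqP cpn vn; have [a b] := egcdnP n p0.
rewrite cpn => E _; apply: val_gt1.
have -> : 1 = a%:R * p%:R - b%:R * n%:R :> algC.
  by rewrite -!natrM E natrD addrC addKr.
apply: val_gtD; last exact/val_gtN/val_gt_nat.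
by apply: val_gt_nat; right; rewrite (place_p hv).
Qed.

Lemma place_root_unity z n : (0 < n)%N -> z ^+ n = 1 -> v z = 0.
Proof.
move=> n0 zn1; have z0 : z != 0.
  by apply: contra_eq_neq zn1 => ->; rewrite expr0n eqn0Ngt n0 eq_sym oner_eq0.
have /esym/eqP := placeX n z0.
by rewrite zn1 place1 mulf_eq0 pnatr_eq0 eqn0Ngt n0 => /eqP.
Qed.

(* If z^n = 1 and z <> 1 then 0 = 1 + z + ... + z^(n-1) is congruent to n modulo
   z - 1. *)
Lemma root_unity_congr n x y : (0 < p)%N -> (0 < n)%N -> coprime p n ->
  x ^+ n = 1 -> y ^+ n = 1 -> val_gt v 0 (x - y) -> x = y.
Proof.
move=> p0 n0 cpn xn yn vxy; apply/eqP/negPn/negP => nxy.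
have y0 : y != 0.
  by apply: contra_eq_neq yn => ->; rewrite expr0n eqn0Ngt n0 eq_sym oner_eq0.
pose z := y^-1 * x.
have zn : z ^+ n = 1 by rewrite exprMn exprVn xn yn invr1 mulr1.
have z1 : z - 1 != 0.
  apply: contra nxy; rewrite subr_eq0 => /eqP E.
  by rewrite -[x](mulVKf y0) -/z E mulr1.
have vz : val_gt v 0 (z - 1).
  rewrite -(mulVf y0) -mulrBr; apply: val_gtM vxy.
  by right; rewrite (@place_root_unity _ n) // exprVn yn invr1.
apply: (val_gt_coprime p0 cpn).
have /eqP : (z - 1) * \sum_(i < n) z ^+ i = 0 by rewrite -subrX1 zn subrr.
rewrite mulf_eq0 (negPf z1) /= => /eqP S0.
have -> : n%:R = - \sum_(i < n) (z ^+ i - 1) :> algC.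
  by rewrite sumrB S0 sub0r opprK sumr_const card_ord.
apply: val_gtN; apply: big_ind => [||i _]; [by left|exact: val_gtD|].
rewrite subrX1 mulrC; apply: val_gtM vz.
have vzj (j : nat) : v (z ^+ j) = 0.
  by apply: (@place_root_unity _ n) => //; rewrite -exprM mulnC exprM zn expr1n.
by apply: big_ind => [||j _]; [by left|exact: val_geD|right; rewrite vzj].
Qed.

(** Both sides are [n]-th roots of unity with the same reduction, and reduction is injective on
    these. *)
Lemma frobenius_root_unity q (s : galQ) z n :
  (0 < p)%N -> (0 < n)%N -> coprime p n -> z ^+ n = 1 ->
  frobenius v q s -> s z = z ^+ q.
Proof.
move=> p0 n0 cpn zn [_ Fs]; apply: (@root_unity_congr n) => //.
- by rewrite -rmorphXn zn rmorph1.
- by rewrite -exprM mulnC exprM zn expr1n.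
- by apply: Fs; right; rewrite (place_root_unity n0 zn).
Qed.

(** Elements of inertia satisfy [frobenius] with [q = 1]. *)
Lemma inertia_root_unity (s : galQ) z n :
  (0 < p)%N -> (0 < n)%N -> coprime p n -> z ^+ n = 1 -> inertia v s -> s z = z.
Proof.
move=> p0 n0 cpn zn [Ds Is]; rewrite -[RHS]expr1.
apply: frobenius_root_unity p0 n0 cpn zn _.
by split=> // x /Is; rewrite expr1.
Qed.

End Place.

(** * The mod [l] cyclotomic character and the residual determinant *)

(** Quantifying over all primitive roots covers whichever [zeta] the definition has chosen. *)
Lemma mod_cyclotomicE l (k : fieldType) (s : galQ) (i : 'I_l) :
  (forall z, l.-primitive_root z -> s z = z ^+ i) ->
  mod_cyclotomic l k s = i%:R.
Proof.
move=> H; rewrite /mod_cyclotomic.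
case: (C_prim_root_exists _) => z /= pz.
have l0 : (0 < l)%N by case: l i {H pz} => [[]|].
rewrite prednK // in pz.
rewrite (H _ pz) (big_pred1 i) // => j /=.
by rewrite (eq_prim_root_expr pz) !modn_small // eq_sym.
Qed.

(** The cyclotomic condition at level [l ^ 1] fixes the determinant modulo [l], and [l] vanishes in
    [k']. *)
Lemma det_residual_cyclotomic l (k k' : finFieldType) (h : {rmorphism k -> k'})
    (Ol : idomainType) (res : {rmorphism Ol -> k'}) (rhobar : galQ -> 'M[k]_2)
    (rho : galQ -> 'M[Ol]_2) (s : galQ) (j : nat) :
  l \in [pchar k] -> residual_of h res rhobar rho -> cyclotomic_det l rho ->
  (forall z, l.-primitive_root z -> s z = z ^+ j) ->
  \det (map_mx h (rhobar s)) = j%:R.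
Proof.
move=> hk [P Pu /(_ s I) E] cyc H.
have [l1 l0] : l%:R = 0 :> k /\ (0 < l)%N.
  by split; [exact: pcharf0|exact/prime_gt0/(pcharf_prime hk)].
have [z pz] := C_prim_root_exists l0.
have [y yE] := cyc 1%N j s z pz (H z pz).
have := congr1 determinant E; rewrite !det_mulmx mulrC => /mulfI.
rewrite -unitfE -unitmxE Pu => /(_ isT) ->.
rewrite det_map_mx yE rmorphD rmorphM !rmorph_nat expn1.
by rewrite -(rmorph_nat h l) l1 rmorph0 mul0r addr0.
Qed.

(** * Matrices in the induced basis *)

Lemma galQ_ext (s t : galQ) : s =1 t -> s = t.
Proof.
case: s t => [f [[m] [[h1 hM]]]] [g [[m'] [[h1' hM']]]] /= /funext E.
move: m h1 hM m' h1' hM'; rewrite /= in E *; rewrite E => m h1 hM m' h1' hM'.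
by rewrite (Prop_irrelevance m m') (Prop_irrelevance h1 h1')
  (Prop_irrelevance hM hM').
Qed.

(** The off-diagonal entries vanish because [c] moves [rd] while [s] fixes it. The entry [b] stays
    unnamed: the determinant will control it. *)
Lemma ind_rep_diag (rd : algC) (c : galQ) (A : comNzRingType) (chi : galQ -> A)
    (s : galQ) : rd != 0 -> c rd = - rd -> s rd = rd ->
  exists b, ind_rep rd c chi s =
            diag_mx (\row_(i < 2) if i == 0 then chi s else b).
Proof.
move=> rd0 crd srd; exists (ind_rep rd c chi s 1 1).
have idV x : algC_invaut galQ1 x = x by exact: (algC_autK galQ1).
have Nrd : (- rd == rd) = false.
  by apply: contraNF rd0; rewrite eq_sym -addr_eq0 -mulr2n mulrn_eq0.
have E0 : galQM (galQM (galQV galQ1) s) galQ1 = s.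
  by apply: galQ_ext => x; rewrite /= idV.
have cVrd : algC_invaut c rd = - rd.
  by apply: (fmorph_inj c); rewrite algC_invautK rmorphN /= crd opprK.
apply/matrixP => -[[|[|//]] i2] [[|[|//]] j2]; rewrite !mxE /=.
- by rewrite E0 srd idV eqxx.
- by rewrite crd rmorphN srd idV Nrd.
- by rewrite srd cVrd Nrd.
- by rewrite mulr1n.
Qed.

(** Invariance is moved to the basis [P] and cleared of inverses of [A], so that a diagonal [B]
    yields one scalar equation per entry. *)
Lemma twisted_commutator (F : fieldType) n (A B P X : 'M[F]_n) (e : F) :
  P \in unitmx -> A \in unitmx -> A *m P = P *m B ->
  e *: (A *m X *m invmx A) = X ->
  let Y := invmx P *m X *m P in e *: (B *m Y) = Y *m B.
Proof.
move=> Pu Au E EX Y.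
have EB : B = invmx P *m (A *m P) by rewrite E mulKmx.
have -> : Y *m B = invmx P *m (X *m A) *m P by rewrite EB /Y !mulmxA mulmxK.
have -> : X *m A = e *: (A *m X) by rewrite -{1}EX -scalemxAl mulmxKV.
by rewrite -scalemxAr -scalemxAl EB /Y !mulmxA mulmxK.
Qed.

(** * Vanishing of the twisted invariants at 3 *)

Theorem proposition5p10
  (* the newform f = sum a_n q^n of level N and the elliptic curve W = E_f *)
  (R : realType) (N : nat) (f : complex R -> complex R) (a : nat -> int)
  (hf : normalized_newform2 N f a)
  (W : weierstrass int) (hW : minimal_model W) (hN : conductor W N)
  (hfW : corresponds a W)
  (* l, kappa, S and the residual representation *)
  (l : nat) (hl : prime l) (hl5 : (5 <= l)%N) (hlN : ~~ (l %| N)%N)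
  (hord : ~~ (l%:Z %| a l)%Z)
  (kappa : finFieldType) (hkappa : l \in [pchar kappa])
  (S : seq (option nat)) (hSinf : None \in S)
  (hSprime : forall p : nat, Some p \in S -> prime p)
  (hSNl : forall p, prime p -> (p %| N * l)%N -> Some p \in S)
  (rhobar : galQ -> 'M[kappa]_2)
  (hrep : representation rhobar) (hcont : continuous_residual rhobar)
  (hunram : unramified_outside rhobar S)
  (hodd : odd_rep rhobar) (hirr : absolutely_irreducible_rep rhobar)
  (* the l-adic representation of f, with enlarged coefficients, of which
     rhobar is the reduction *)
  (kappa' : finFieldType) (iota : {rmorphism kappa -> kappa'})
  (Ol : idomainType) (res : {rmorphism Ol -> kappa'})
  (hOl : coefficient_ring res)
  (rho : galQ -> 'M[Ol]_2) (hrho : attached_rep N l a rho)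
  (hres : residual_of iota res rhobar rho)
  (* the prime 3 *)
  (h9 : (9 %| N)%N)
  (v : algC -> rat) (hv : place_over 3 v)
  (hadd : additive_reduction 3 W) (hpot : potentially_good v W)
  (* K = Q_3(rd), rd^2 = d, c generates Gal(K/Q_3), chi is the inducing
     character *)
  (d : int) (rd : algC) (hrd : rd ^+ 2 = d%:~R)
  (c : galQ) (hc : decomposition v c) (hcrd : c rd = - rd)
  (rec : algC -> galQ)
  (hrec : local_reciprocity v (decompositionK v rd) 3 2^-1 rec)
  (chi : galQ -> Ol) (hchi : adic_character l (decompositionK v rd) chi)
  (hind : equiv_on (decomposition v)
            (fun s => map_mx (@tofrac Ol) (rho s))
            (fun s => map_mx (@tofrac Ol) (ind_rep rd c chi s)))
  (hindbar : equiv_on (decomposition v)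
               (fun s => map_mx iota (rhobar s)) (ind_rep rd c (res \o chi)))
  (hchibar : exists2 s, decompositionK v rd s &
               res (chi s) != res (conj_char c chi s))
  (hmin : minimally_ramified_char v rd rec res chi)
  (htype : ramified_sc_type3 v d rd rec chi) :
  let H0 := H0_ad0 (decomposition v) (mod_cyclotomic l kappa) rhobar in
  [/\ ~ (3 = 1 %[mod l%:Z])%Z /\ ~ (3 = -1 %[mod l%:Z])%Z -> \dim H0 = 0%N,
      (3 = -1 %[mod l%:Z])%Z -> \dim H0 = 0%N
    & (3 = 1 %[mod l%:Z])%Z -> \dim H0 = 0%N].
Proof.
move=> H0; suff H00 : \dim H0 = 0%N by split.
have charl' : l \in [pchar kappa'] by rewrite (fmorph_pchar iota).
have nat_neq0 n : (0 < n < 5)%N -> n%:R != 0 :> kappa'.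
  move=> /andP[n0 n5]; rewrite -(dvdn_pcharf charl') gtnNdvd //.
  exact: leq_trans n5 hl5.
have co3l : coprime 3 l.
  by rewrite prime_coprime // dvdn_prime2 // neq_ltn (leq_trans _ hl5).
have l0 := prime_gt0 hl.
have [d3 ord6] : (d = 3 \/ d = -3) /\ order_on (inertiaK v rd) chi 6%N.
  by case: htype => [[]|[]|[[]]]; split=> //; [left|right|right].
have d3C : v d%:~R = 1 /\ (d%:~R : algC) != 0.
  case: d3 => ->; rewrite ?rmorphN /= ?(placeN hv) ?oppr_eq0;
  by rewrite (place_p hv) pnatr_eq0.
have rd0 : rd != 0.
  by apply: contraNneq d3C.2 => E; rewrite -hrd E expr0n.
(* Thus [rd] has the valuation of a uniformizer of K, so [rec rd] is a Frobenius. *)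
have vrd : v rd = 2^-1.
  have := placeX hv 2 rd0; rewrite hrd d3C.1 => E.
  by rewrite -[LHS](mulKf (_ : 2 != 0)) // -E mulr1.
have [P Pu HP] := hindbar.
have ind s : decompositionK v rd s -> exists b,
    ind_rep rd c (res \o chi) s =
    diag_mx (\row_(i < 2) if i == 0 then res (chi s) else b).
  by move=> [_ srd]; exact: ind_rep_diag.
pose cj (X : 'M[kappa]_2) := invmx P *m map_mx iota X *m P.
(* Applied below with [j = 3] to a Frobenius and [j = 1] to an inertia element; [dg] is the diagonal
   of the induced matrix. *)
have key s (j : nat) : decompositionK v rd s -> (0 < j < 5)%N ->
    (forall z, l.-primitive_root z -> s z = z ^+ j) ->
  exists2 dg : 'rV[kappa']_2, dg 0 0 = res (chi s) & dg 0 0 * dg 0 1 = j%:R /\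
    forall X, X \in H0 -> forall i k,
      j%:R * dg 0 i * cj X i k = cj X i k * dg 0 k.
  move=> Ks j05 Hj; have [b Eb] := ind s Ks.
  exists (\row_(i < 2) if i == 0 then res (chi s) else b); first by rewrite mxE.
  have detj := det_residual_cyclotomic hkappa hres (attached_det hrho) Hj.
  have Eind := HP s Ks.1; rewrite Eb in Eind; split.
    have := congr1 determinant Eind; rewrite !det_mulmx detj mulrC => /mulfI.
    rewrite -unitfE -unitmxE Pu => /(_ isT) ->.
    by rewrite det_diag !big_ord_recl big_ord0 mulr1 !mxE.
  move=> X /mem_H0_ad0[_ /(_ s Ks.1)].
  have jl : (j < l)%N by case/andP: j05 => _ /leq_trans; exact.
  rewrite (@mod_cyclotomicE l kappa s (Ordinal jl)) //=.
  move=> /(congr1 (map_mx iota)).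
  rewrite map_mxZ !map_mxM map_invmx rmorph_nat => EX i k.
  have Au : map_mx iota (rhobar s) \in unitmx.
    by rewrite unitmxE detj unitfE nat_neq0.
  have /matrixP/(_ i k) := twisted_commutator Pu Au Eind EX.
  by rewrite -/(cj X) mul_diag_mx mul_mx_diag !mxE mulrA.
have [frob Kfrob ffrob] : exists2 s, decompositionK v rd s & frobenius v 3 s.
  have Krd : fixed_field (decompositionK v rd) rd by move=> s [].
  case: hrec => Grec _ Frec _.
  by exists (rec rd); [exact: Grec|exact: Frec].
have [s [Is srd] chis2] : exists2 s, inertiaK v rd s & chi s ^+ 2 != 1.
  by case: ord6 => _ _; exact.
(* Here [t = chi s ^+ 2] is a cube root of unity other than 1, so [1 + t + t ^+ 2 = 0]; if [t]
   reduced to 1, this would give 3 = 0 in [kappa']. *)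
have reschis2 : res (chi s) ^+ 2 != 1.
  have /eqP : (chi s ^+ 2 - 1) * \sum_(i < 3) (chi s ^+ 2) ^+ i = 0.
    by case: ord6 => _ /(_ s (conj Is srd)) E _; rewrite -subrX1 -exprM E subrr.
  rewrite mulf_eq0 subr_eq0 (negPf chis2) /= => /eqP/(congr1 res).
  rewrite rmorph_sum rmorph0 => E.
  apply: contra_eq_neq E => E; under eq_bigr => i _ do rewrite !rmorphXn E expr1n.
  by rewrite sumr_const card_ord nat_neq0.
have rootl (z : algC) : l.-primitive_root z -> z ^+ l = 1.
  by exact: prim_expr_order.
have [dF _ [detF comF]] := key frob 3%N Kfrob isT
  (fun z pz => frobenius_root_unity hv isT l0 co3l (rootl z pz) ffrob).
have [dI dI0 [detI comI]] := key s 1%N (conj Is.1 srd) isT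
  (fun z pz => inertia_root_unity hv isT l0 co3l (rootl z pz) Is).
have row2 (u : 'rV[kappa']_2) j : u 0 j = if j == 0 then u 0 0 else u 0 1.
  by case: j => -[|[|//]] ltj; congr (u 0 _); exact: val_inj.
(* The two entries multiply to 1, so equality would make [res (chi s)] square to 1. *)
have sepI : dI 0 0 != dI 0 1.
  by apply: contra_neq reschis2; rewrite -dI0 expr2 => {2}->.
apply/eqP; rewrite dimv_eq0 -subv0; apply/subvP => X HX; rewrite memv0.
rewrite -(map_mx_eq0 iota).
suff Y0 : cj X = 0.
  have := congr1 (fun M => P *m M *m invmx P) Y0.
  by rewrite /cj -!mulmxA mulKVmx // mulmxV // mulmx1 mul0mx mulmx0 => ->.
apply/matrixP => i k; rewrite [RHS]mxE.
(* On the diagonal, Frobenius gives [3 * d * e = e * d], hence [2 * (d * e) = 0] with [d]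
   nonzero. *)
have [<-|ik] := eqVneq i k.
  have dFi : dF 0 i != 0.
    have : dF 0 0 * dF 0 1 != 0 by rewrite detF nat_neq0.
    by rewrite mulf_eq0 negb_or (row2 dF i) => /andP[]; case: ifP.
  have /eqP : 2 * (dF 0 i * cj X i i) = 0.
    rewrite (_ : 2 = 3 - 1 :> kappa'); last by rewrite (mulrSr 1 2) addrK.
    by rewrite mulrBl mul1r mulrA comF // mulrC subrr.
  by rewrite mulf_eq0 (negPf (nat_neq0 2%N isT)) mulf_eq0 (negPf dFi) => /eqP.
(* Off the diagonal, inertia gives [e * (d_i - d_k) = 0] with distinct [d_i], [d_k]. *)
have /eqP := comI X HX i k.
rewrite mul1r mulrC -subr_eq0 -mulrBr mulf_eq0 subr_eq0 => /orP[/eqP//|].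
rewrite (row2 dI i) (row2 dI k) => /eqP E.
case: i k ik E => -[|[|//]] ? [[|[|//]] ?] //= _.
  by move/eqP; rewrite (negPf sepI).
by move/esym/eqP; rewrite (negPf sepI).
Qed.
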